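(* Let $n \geq 2$ and $m$ be integers with $0 \leq m < \binom{n}{2}$. Let $s,t$ be the (unique) natural numbers such that $\binom{n}{2}-m=\binom{s}{2}+t$ with $0<t\leq s$. Let $\alpha_u$ denote the maximum of the independence number $\alpha(G)$ over all simple graphs $G$ with $n$ vertices and $m$ edges. Then $$s=\begin{cases}\alpha_u-1 & \text{if } \binom{n}{2}-m=\binom{s}{2}+s,\\ \alpha_u & \text{otherwise.}\end{cases}$$
   Context: All graphs are finite and simple. A $G(n,m)$ graph is a graph with $n$ vertices and $m$ edges. The independence number $\alpha(G)$ is the maximum size of an independent set of $G$. $\alpha_u$ is the sharp upper bound for the independence number of $G(n,m)$ graphs, i.e. the largest independence number attained by a graph with $n$ vertices and $m$ edges. *)

(* Defs.v *)
From HB Require Import structures.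
From mathcomp Require Import all_boot.

Set Implicit Arguments.
Unset Strict Implicit.
Unset Printing Implicit Defensive.

(* A finite simple graph on the vertex set T is its set of edges, an edge being
   a two-element set of vertices (so no loops, no multiple edges). *)
Record sgraph (T : finType) := SGraph {
  edges : {set {set T}};
  edgesP : [forall e in edges, #|e| == 2] }.

HB.instance Definition _ (T : finType) := [isSub for @edges T].
HB.instance Definition _ (T : finType) := [Finite of sgraph T by <:].

Definition adj (T : finType) (G : sgraph T) (x y : T) : bool :=
  [set x; y] \in edges G.

Definition independent (T : finType) (G : sgraph T) (A : {set T}) : bool :=
  [forall x in A, forall y in A, ~~ adj G x y].

Definition independence_number (T : finType) (G : sgraph T) : nat :=
  \max_(A : {set T} | independent G A) #|A|.

(* The maximum is over labelled graphs on 'I_n; alpha_u_max and alpha_u_attained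
   below show that this is the maximum over graphs on any n-element vertex
   set. The value is the irrelevant 0 when 'C(n, 2) < m. *)
Definition alpha_u (n m : nat) : nat :=
  \max_(G : sgraph 'I_n | #|edges G| == m) independence_number G.

Section Transport.
Variables (T U : finType) (f : T -> U).
Hypothesis f_inj : injective f.

Fact map_edgesP (G : sgraph T) :
  [forall e in [set f @: (e : {set T}) | e in edges G], #|e| == 2].
Proof.
apply/forall_inP => _ /imsetP[e eG ->].
by rewrite card_imset //; exact: (forall_inP (edgesP G)).
Qed.

Definition map_sgraph (G : sgraph T) : sgraph U := SGraph (map_edgesP G).

Lemma card_map_sgraph G : #|edges (map_sgraph G)| = #|edges G|.
Proof. by rewrite card_imset //; exact: imset_inj. Qed.

Lemma adj_map_sgraph G x y : adj (map_sgraph G) (f x) (f y) = adj G x y.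
Proof.
rewrite /adj /=.
have -> : [set f x; f y] = f @: [set x; y] by rewrite imsetU !imset_set1.
by rewrite mem_imset //; exact: imset_inj.
Qed.

Lemma independence_number_map G :
  independence_number G <= independence_number (map_sgraph G).
Proof.
apply/bigmax_leqP => A indA; rewrite -(card_imset A f_inj).
apply: (@leq_bigmax_cond _ _ (fun B : {set U} => #|B|)).
apply/forall_inP => _ /imsetP[x xA ->].
apply/forall_inP => _ /imsetP[y yA ->].
by rewrite adj_map_sgraph; move/forall_inP/(_ x xA)/forall_inP/(_ y yA): indA.
Qed.

End Transport.

Lemma alpha_u_max (n m : nat) (T : finType) (G : sgraph T) :
  #|T| = n -> #|edges G| = m -> independence_number G <= alpha_u n m.
Proof.
move=> <- Gm; apply: leq_trans (independence_number_map enum_rank_inj G) _.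
apply: (@leq_bigmax_cond _ _ (fun H => independence_number H)).
by rewrite card_map_sgraph ?Gm //; exact: enum_rank_inj.
Qed.

Lemma sgraph_exists (n m : nat) :
  m <= 'C(n, 2) -> exists G : sgraph 'I_n, #|edges G| = m.
Proof.
move=> le_m; pose S : {set {set 'I_n}} := [set e : {set 'I_n} | #|e| == 2].
have cS : #|S| = 'C(n, 2) by rewrite card_draws card_ord.
pose E := [set e : {set 'I_n} in take m (enum S)].
have EP : [forall e in E, #|e| == 2].
  by apply/forall_inP => e; rewrite inE => /mem_take; rewrite mem_enum inE.
exists (SGraph EP); rewrite /= cardsE.
rewrite (card_uniqP _) ?take_uniq ?enum_uniq //.
by rewrite size_takel // -cardE cS.
Qed.

Lemma alpha_u_attained (n m : nat) : m <= 'C(n, 2) ->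
  exists2 G : sgraph 'I_n, #|edges G| = m & independence_number G = alpha_u n m.
Proof.
case/sgraph_exists => G0 G0m; rewrite /alpha_u.
have /(eq_bigmax_cond (fun G => independence_number G)) [G Gm ->] :
  0 < #|[pred G : sgraph 'I_n | #|edges G| == m]|.
  by apply/card_gt0P; exists G0; rewrite inE G0m.
by exists G => //; apply/eqP.
Qed.

Lemma binomial_decomposition (N : nat) : 0 < N ->
  exists! st : nat * nat, N = 'C(st.1, 2) + st.2 /\ 0 < st.2 <= st.1.
Proof.
move=> N_gt0.
have [[s t] [defN tP]] :
    exists st : nat * nat, N = 'C(st.1, 2) + st.2 /\ 0 < st.2 <= st.1.
  elim: N N_gt0 => // -[_ _|N /(_ isT)[[s t] /= [-> /andP[t0]]]].
    by exists (1, 1).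
  rewrite leq_eqVlt => /predU1P[->|lt_ts].
    by exists (s.+1, 1); rewrite /= binS bin1 addn1 addnC.
  by exists (s, t.+1); rewrite /= addnS.
exists (s, t); split=> // -[s' t'] /= [defN' tP'] /=.
have lt_bin a b c d : 0 < d -> c <= a -> a < b -> 'C(a, 2) + c < 'C(b, 2) + d.
  move=> d0 ca ab; apply: (@leq_ltn_trans 'C(a.+1, 2)).
    by rewrite binS bin1 leq_add2l.
  by rewrite -addn1 leq_add // leq_bin2l.
move: defN defN' tP tP' => /= -> e /andP[t0 ts] /andP[t0' ts'].
have [ss'|ss'|ss'] := ltngtP s s'.
- by have := lt_bin s s' t t' t0' ts ss'; rewrite e ltnn.
- by have := lt_bin s' s t' t t0 ts' ss'; rewrite e ltnn.
- by move: e; rewrite ss' => /addnI->.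
Qed.

(* Main.v *)
Require Import Defs.
From mathcomp Require Import all_boot.

(** A graph with an independent [k]-set misses the ['C(k, 2)] pairs inside it,
    and conversely any [m] of the other pairs form a graph in which that [k]-set
    is independent. Hence [k <= alpha_u n m] exactly when
    ['C(k, 2) + m <= 'C(n, 2)], and the theorem compares ['C(n, 2) - m] with
    consecutive triangular numbers. *)

Lemma exists_subset_card (T : finType) (S : {set T}) (k : nat) :
  k <= #|S| -> exists2 B : {set T}, B \subset S & #|B| = k.
Proof.
move=> /card_geqP[r [r_uniq r_size rS]]; exists [set x in r].
  by apply/subsetP => x; rewrite inE; exact: rS.
by rewrite cardsE (card_uniqP r_uniq).
Qed.

(** Since edges are two-element sets, adjacency inside [A] becomes containment of an edge in [A],
    the form that suits counting pairs. *)
Lemma independentP (T : finType) (G : sgraph T) (A : {set T}) :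
  reflect (forall e, e \in edges G -> ~~ (e \subset A)) (independent G A).
Proof.
apply: (iffP idP) => [indA e eG | noedge].
  have /cards2P[x [y [_ def_e]]] := forall_inP (edgesP G) e eG.
  apply/negP; rewrite def_e subUset !sub1set => /andP[xA yA].
  by have := forall_inP (forall_inP indA x xA) y yA; rewrite /adj -def_e eG.
apply/forall_inP => x xA; apply/forall_inP => y yA; apply/negP => /noedge.
by rewrite subUset !sub1set xA yA.
Qed.

Lemma independent_card_edges {T : finType} {G : sgraph T} {A : {set T}} :
  independent G A -> 'C(#|A|, 2) + #|edges G| <= 'C(#|T|, 2).
Proof.
move=> /independentP indA; rewrite -cards_draws -card_draws.
set P := [set _ | _ & _].
have disjP : P :&: edges G = set0.
  apply/setP => e; rewrite !inE; apply/negP => /andP[/andP[eA _] eG].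
  by have := indA e eG; rewrite eA.
rewrite -cardsUI disjP cards0 addn0; apply/subset_leq_card/subsetP => e.
rewrite !inE => /orP[/andP[] // | eG].
exact: (forall_inP (edgesP G)).
Qed.

Lemma exists_independent {T : finType} {A : {set T}} {m : nat} :
  'C(#|A|, 2) + m <= 'C(#|T|, 2) ->
  exists2 G : sgraph T, #|edges G| = m & independent G A.
Proof.
rewrite -cards_draws -card_draws.
set P := [set _ | _ & _]; set Q := [set _ | _] => le_m.
have sPQ : P \subset Q by apply/subsetP => e; rewrite !inE => /andP[].
(* [Q] holds all pairs and [P] those inside [A]; the hypothesis leaves at least [m] pairs in the
   difference. *)
have [|E sEQP cE] := @exists_subset_card _ (Q :\: P) m.
  by rewrite cardsDS // leq_subRL ?subset_leq_card.
have edgeE : [forall e in E, #|e| == 2].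
  by apply/forall_inP => e /(subsetP sEQP); rewrite !inE => /andP[].
exists (SGraph edgeE) => //; apply/independentP => e /(subsetP sEQP).
by rewrite !inE => /andP[PNe e2]; move: PNe; rewrite e2 andbT.
Qed.

(** Passing from [n] to [n.+1] adds [n] to the binomial, a strict increase once [n] is positive;
    ['C(0, 2)] and ['C(1, 2)] coincide. *)
Lemma leq_of_bin2 (k n : nat) : 0 < n -> 'C(k, 2) <= 'C(n, 2) -> k <= n.
Proof.
move=> n_gt0; apply: contraTT; rewrite -!ltnNge => lt_nk.
apply: leq_trans (leq_bin2l 2 lt_nk).
by rewrite binS bin1 -addn1 leq_add2l.
Qed.

Lemma leq_alpha_u (n m k : nat) : 0 < n -> m <= 'C(n, 2) ->
  (k <= alpha_u n m) = ('C(k, 2) + m <= 'C(n, 2)).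
Proof.
move=> n_gt0 le_m; apply/idP/idP => [le_k | le_km].
  have [G Gm Galpha] := alpha_u_attained le_m.
  (* The empty set is independent, so some independent [A] attains the maximum. *)
  have [|A indA cA] :=
    @eq_bigmax_cond _ (independent G) (fun A : {set 'I_n} => #|A|).
    apply/card_gt0P; exists set0.
    by apply/forall_inP => x; rewrite inE.
  have := independent_card_edges indA; rewrite card_ord Gm; apply: leq_trans.
  by rewrite leq_add2r leq_bin2l // -cA -/(independence_number G) Galpha.
(* This bound ensures that ['I_n] has a subset with [k] elements. *)
have le_kn : k <= n.
  exact: leq_of_bin2 n_gt0 (leq_trans (leq_addr _ _) le_km).
have [|A _ cA] := @exists_subset_card 'I_n setT k.
  by rewrite cardsT card_ord.
have [|G Gm indA] := @exists_independent _ A m; first by rewrite cA card_ord.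
apply: leq_trans (alpha_u_max (card_ord n) Gm); rewrite -cA.
exact: (@leq_bigmax_cond _ _ (fun B : {set 'I_n} => #|B|)).
Qed.

Theorem theorem3 (n m s t : nat) :
  2 <= n -> m < 'C(n, 2) ->
  'C(n, 2) - m = 'C(s, 2) + t -> 0 < t <= s ->
  s = if 'C(n, 2) - m == 'C(s, 2) + s then alpha_u n m - 1 else alpha_u n m.
Proof.
move=> n_ge2 lt_m defN /andP[t_gt0 le_ts].
have leE k : (k <= alpha_u n m) = ('C(k, 2) <= 'C(s, 2) + t).
  by rewrite leq_alpha_u ?(ltnW lt_m) ?(ltnW n_ge2) // -defN leq_subRL 1?addnC // ltnW.
(* If [t = s], the right side of [leE] is exactly ['C(s.+1, 2)], which ['C(s.+2, 2)] exceeds by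
   [s.+1]. *)
rewrite defN eqn_add2l; have [ts | ts] := eqVneq t s.
  suff -> : alpha_u n m = s.+1 by rewrite subn1.
  apply/eqP; rewrite eqn_leq leE binS bin1 ts leqnn andbT.
  by rewrite leqNgt leE !(binS _ 1) !bin1 ts -ltnNge addnS ltnS leq_addr.
(* Here [t < s], so ['C(s, 2) + t] lies below ['C(s.+1, 2) = 'C(s, 2) + s]. *)
apply/eqP; rewrite eqn_leq leE leq_addr leqNgt leE binS bin1 -ltnNge.
by rewrite ltn_add2l ltn_neqAle ts.
Qed.
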